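(* Let $(\mathcal T(n))_{n\in\mathbb N}$ be the triangle Markov chain obtained by iterated random barycentric subdivision started from an arbitrary triangle, and for each $n$ let $A_n$ be the largest angle of $\mathcal T(n)$, i.e. the angle at the vertex $(X_n,Y_n)$ of its normalized form, between the segments $[(X_n,Y_n),(0,0)]$ and $[(X_n,Y_n),(1,0)]$, where $(X_n,Y_n)$ is the characterizing point of $\mathcal T(n)$. Then for every $\epsilon>0$, $$\lim_{n\to\infty}\mathbb P[A_n<\pi-\epsilon]=0 .$$
   Context: A triangle is given by three points of the plane which are not all equal. Barycentric subdivision: if a triangle has vertices $A,B,C$, let $D,E,F$ be the midpoints of $[A,B],[B,C],[C,A]$ and $G$ its barycenter; the medians cut it into the six triangles $\{A,D,G\},\{D,B,G\},\{B,E,G\},\{E,C,G\},\{C,F,G\},\{F,A,G\}$. The triangle Markov chain: $\mathcal T(0)$ is given and $\mathcal T(n+1)$ is chosen uniformly among the six triangles of the barycentric subdivision of $\mathcal T(n)$, independently of the past. Characterizing point: there is a similitude mapping the triangle onto a triangle with vertices $(0,0)$, $(1,0)$, $(x,y)$, $0\le x\le1/2$, $y\ge0$, sending its longest edge onto $[(0,0),(1,0)]$ and its shortest edge onto $[(0,0),(x,y)]$; $(x,y)$ is unique and is the characterizing point; this image triangle is the normalized form. *)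

(* Defs.v *)
From HB Require Import structures.
From mathcomp Require Import all_boot all_order all_algebra.
From mathcomp Require Import all_classical all_reals all_analysis.
Set Implicit Arguments. Unset Strict Implicit. Unset Printing Implicit Defensive.
Import Order.TTheory GRing.Theory Num.Theory.
Local Open Scope ring_scope.

Section Triangles.
Variable R : realType.

Definition point := (R * R)%type.
Definition triangle := (point * point * point)%type.

Definition tA (t : triangle) : point := t.1.1.
Definition tB (t : triangle) : point := t.1.2.
Definition tC (t : triangle) : point := t.2.

Definition not_all_equal (t : triangle) : Prop :=
  ~ (tA t = tB t /\ tB t = tC t).

Definition midpoint (p q : point) : point :=
  ((p.1 + q.1) / 2, (p.2 + q.2) / 2).

Definition barycenter (t : triangle) : point :=
  (((tA t).1 + (tB t).1 + (tC t).1) / 3, ((tA t).2 + (tB t).2 + (tC t).2) / 3).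

Definition subdiv (t : triangle) (i : 'I_6) : triangle :=
  let A := tA t in let B := tB t in let C := tC t in
  let D := midpoint A B in let E := midpoint B C in let F := midpoint C A in
  let G := barycenter t in
  match val i with
  | 0 => (A, D, G)
  | 1 => (D, B, G)
  | 2 => (B, E, G)
  | 3 => (E, C, G)
  | 4 => (C, F, G)
  | _ => (F, A, G)
  end.

Fixpoint iter_subdiv (t : triangle) (n : nat) (w : nat -> 'I_6) : triangle :=
  match n with
  | 0 => t
  | k.+1 => subdiv (iter_subdiv t k w) (w k)
  end.

Definition dist (p q : point) : R :=
  Num.sqrt ((p.1 - q.1) ^+ 2 + (p.2 - q.2) ^+ 2).

Definition edges (t : triangle) : R * R * R :=
  (dist (tA t) (tB t), dist (tB t) (tC t), dist (tC t) (tA t)).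
Definition longest (t : triangle) : R :=
  Num.max (edges t).1.1 (Num.max (edges t).1.2 (edges t).2).
Definition shortest (t : triangle) : R :=
  Num.min (edges t).1.1 (Num.min (edges t).1.2 (edges t).2).
Definition middle (t : triangle) : R :=
  (edges t).1.1 + (edges t).1.2 + (edges t).2 - longest t - shortest t.

(* characterizing point (x,y): 0 <= x <= 1/2, y >= 0, with
   |(x,y)| = shortest/longest and |(x,y) - (1,0)| = middle/longest,
   i.e. the image of the vertex opposite to the longest edge under the
   normalizing similitude. *)
Definition char_point (t : triangle) : point :=
  let a := longest t in let b := middle t in let c := shortest t in
  let x := (a ^+ 2 + c ^+ 2 - b ^+ 2) / (2 * a ^+ 2) in
  (x, Num.sqrt ((c / a) ^+ 2 - x ^+ 2)).

Definition angle (p q r : point) : R :=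
  let u := (q.1 - p.1, q.2 - p.2) in let v := (r.1 - p.1, r.2 - p.2) in
  acos ((u.1 * v.1 + u.2 * v.2) / (dist p q * dist p r)).

Definition largest_angle (t : triangle) : R :=
  angle (char_point t) (0, 0) (1, 0).

(* P[A_n < pi - eps] for the triangle Markov chain started at t0: the
   choices are i.i.d. uniform on the six subtriangles, so the law of T(n)
   is the image of the uniform distribution on words w : 'I_n -> 'I_6. *)
Definition prob_angle_lt (t0 : triangle) (eps : R) (n : nat) : R :=
  #|[set w : {ffun 'I_n -> 'I_6} |
      largest_angle (iter_subdiv t0 n (fun k =>
         if insub k is Some k' then w k' else ord0)) < pi - eps]|%:R
  / (6 ^ n)%:R.

End Triangles.

(* Main.v *)
Require Import Defs.
From HB Require Import structures.
From mathcomp Require Import all_boot all_order all_algebra.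
From mathcomp Require Import all_classical all_reals all_analysis.
From mathcomp Require Import zify ring lra.
Import Order.TTheory GRing.Theory Num.Theory.
Local Open Scope classical_set_scope.
Local Open Scope ring_scope.

(** The area of a triangle is divided by 6 at each step, so an angle bounded away
    from pi forces the square of the shortest edge to be O(6^-n). Projecting on a
    coordinate axis along which the triangle is not constant, it suffices that,
    for the edge vectors [v = (B - A, C - A)] of the projected triangle rescaled
    by [6^n], each edge (a linear form in [v]) has square at most [M 6^n] with
    vanishing probability. The rescaled chain multiplies [v] by one of six integer
    matrices of determinant 6.

    Growth: for the quadratic form [Q = x^2 - x y + y^2], the mean of
    [Q^(-1/2)] over the six children is at most [6^(-1/2) * 3067/3072] times its
    value at the parent, hence [Q(v_n) <= L 6^n] has exponentially small
    probability.

    Non-concentration: consider a linear form with integer coefficients that are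
    equal and nonzero modulo 3. Its six pullbacks have the same property, and
    modulo 9 they fall into three classes, of two matrices each, that are never
    proportional. Two non-proportional integer forms cannot both be small at a
    large vector, so at a large [v] at most [2^k] of the [6^k] words of length [k]
    make the form small. The edges pull back to such forms after a few steps. *)

(** * Sums over words and the law of the chain *)

(* Sum of [g] over the [6 ^ n] states reached from [t] by words of length [n]. *)
Fixpoint wsum {R : realType} {T : Type} (step : T -> 'I_6 -> T) (n : nat)
    (g : T -> R) (t : T) : R :=
  if n is k.+1 then \sum_(i < 6) wsum step k g (step t i) else g t.

Section WordSums.
Context {R : realType} {T : Type} (step : T -> 'I_6 -> T).
Implicit Types (g h : T -> R) (t : T).

Lemma wsumD m n g t : wsum step (m + n) g t = wsum step m (wsum step n g) t.
Proof. by elim: m t => //= m IH t; apply: eq_bigr => i _; rewrite IH. Qed.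

Lemma wsumSr n g t :
  wsum step n.+1 g t = wsum step n (fun u => \sum_(i < 6) g (step u i)) t.
Proof. by rewrite -addn1 wsumD. Qed.

Lemma le_wsum n g h t :
  (forall u, g u <= h u) -> wsum step n g t <= wsum step n h t.
Proof. by move=> gh; elim: n t => //= n IH t; apply: ler_sum => i _. Qed.

Lemma wsum_ge0 n g t : (forall u, 0 <= g u) -> 0 <= wsum step n g t.
Proof. by move=> g0; elim: n t => //= n IH t; apply: sumr_ge0 => i _. Qed.

Lemma wsum_add n g h t :
  wsum step n (fun u => g u + h u) t = wsum step n g t + wsum step n h t.
Proof.
by elim: n t => //= n IH t; rewrite -big_split; apply: eq_bigr => i _; rewrite IH.
Qed.

Lemma wsum_sum (I : finType) n (G : I -> T -> R) t :
  wsum step n (fun u => \sum_i G i u) t = \sum_i wsum step n (G i) t.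
Proof.
elim: n t => //= n IH t; rewrite exchange_big.
by apply: eq_bigr => i _; rewrite IH.
Qed.

Lemma wsumZ n (a : R) g t :
  wsum step n (fun u => a * g u) t = a * wsum step n g t.
Proof.
by elim: n t => //= n IH t; rewrite mulr_sumr; apply: eq_bigr => i _; rewrite IH.
Qed.

Lemma wsum_cst n (a : R) t : wsum step n (fun=> a) t = 6 ^+ n * a.
Proof.
elim: n t => /= [|n IH] t; first by rewrite mul1r.
under eq_bigr => i _ do rewrite IH.
by rewrite sumr_const card_ord exprS -mulrA mulr_natl.
Qed.

End WordSums.

(** Coupling: both chains read the same letters. The relation depends on time so that it can carry
    factors [6 ^+ k]; with equal chains it restricts a comparison to states satisfying an
    invariant. *)
Lemma le_wsum_rel {R : realType} {T U : Type} (stepT : T -> 'I_6 -> T)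
    (stepU : U -> 'I_6 -> U) (rel : nat -> T -> U -> Prop)
    (g : T -> R) (h : U -> R) n j t u :
  (forall k a b i, rel k a b -> rel k.+1 (stepT a i) (stepU b i)) ->
  (forall a b, rel (j + n)%N a b -> g a <= h b) ->
  rel j t u -> wsum stepT n g t <= wsum stepU n h u.
Proof.
move=> rel_step; elim: n j t u => [|n IH] j t u gh tu /=.
  by apply: gh; rewrite addn0.
apply: ler_sum => i _; apply: (IH j.+1); last exact: rel_step.
by move=> a b; rewrite addSnnS; apply: gh.
Qed.

(** The default [ord0] is never read: [iter_subdiv t n] only uses letters of index below [n]. *)
Definition extend_word {n} (w : {ffun 'I_n -> 'I_6}) (k : nat) : 'I_6 :=
  if insub k is Some k' then w k' else ord0.

Definition rcons_word {n} (p : {ffun 'I_n -> 'I_6} * 'I_6) : {ffun 'I_n.+1 -> 'I_6} :=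
  [ffun k => if unlift ord_max k is Some j then p.1 j else p.2].

Lemma rcons_word_bij n : bijective (@rcons_word n).
Proof.
exists (fun f : {ffun 'I_n.+1 -> 'I_6} =>
          ([ffun j => f (lift ord_max j)], f ord_max)).
- move=> [w i]; rewrite /rcons_word /= ffunE unlift_none; congr (_, _).
  by apply/ffunP => j; rewrite !ffunE liftK.
- move=> f; apply/ffunP => k; rewrite ffunE /=.
  by case: unliftP => [j ->|->] //; rewrite ffunE.
Qed.

Lemma extend_word_rcons_lt n (w : {ffun 'I_n -> 'I_6}) i k :
  (k < n)%N -> extend_word (rcons_word (w, i)) k = extend_word w k.
Proof.
move=> kn; rewrite /extend_word.
case: insubP => [j _ jk|]; last by rewrite ltnW.
case: insubP => [j' _ j'k|]; last by rewrite kn.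
rewrite ffunE; have -> : j = lift ord_max j'.
  by apply: val_inj; rewrite [RHS]lift_max jk j'k.
by rewrite liftK.
Qed.

Lemma extend_word_rcons_last n (w : {ffun 'I_n -> 'I_6}) i :
  extend_word (rcons_word (w, i)) n = i.
Proof.
rewrite /extend_word; case: insubP => [j _ jn|]; last by rewrite ltnSn.
have -> : j = ord_max by exact: val_inj.
by rewrite ffunE unlift_none.
Qed.

Lemma eq_iter_subdiv {R : realType} (t : triangle R) n w w' :
  (forall k, (k < n)%N -> w k = w' k) ->
  iter_subdiv t n w = iter_subdiv t n w'.
Proof.
elim: n => //= n IH ww'; rewrite ww' // IH // => k kn.
by rewrite ww' // ltnW.
Qed.

(** Induction on the last letter, the one [iter_subdiv] applies last; [wsumSr] splits the word sum
    at the same place. *)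
Lemma sum_words_wsum {R : realType} (t : triangle R) n (g : triangle R -> R) :
  \sum_(w : {ffun 'I_n -> 'I_6}) g (iter_subdiv t n (extend_word w))
  = wsum (@subdiv R) n g t.
Proof.
elim: n g => [|n IH] g.
  by rewrite /= sumr_const card_ffun !card_ord.
rewrite wsumSr -IH (reindex _ (onW_bij _ (@rcons_word_bij n))) /=.
rewrite -(pair_bigA _ (fun (w : {ffun 'I_n -> 'I_6}) i =>
  g (subdiv (iter_subdiv t n (extend_word (rcons_word (w, i))))
            (extend_word (rcons_word (w, i)) n)))) /=.
apply: eq_bigr => w _; apply: eq_bigr => i _.
rewrite extend_word_rcons_last; congr (g (subdiv _ _)).
by apply: eq_iter_subdiv => k kn; rewrite extend_word_rcons_lt.
Qed.

Lemma prob_angle_ltE {R : realType} (t0 : triangle R) eps n :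
  prob_angle_lt t0 eps n =
  wsum (@subdiv R) n (fun t => (largest_angle t < pi - eps)%R%:R) t0 / 6 ^+ n.
Proof.
rewrite /prob_angle_lt -sum_words_wsum natrX; congr (_ / _).
rewrite -natr_sum; congr (_%:R).
rewrite -sum1_card big_mkcond; apply: eq_bigr => w _.
by rewrite inE; case: ifP.
Qed.

(** * Growth of the projected chain *)

Section Growth.
Context {R : realType}.
Implicit Types (v : R * R) (i : 'I_6).

(* [(B - A, C - A)] for the [i]-th piece of a triangle on the line, times 6. *)
Definition child v i : R * R :=
  let: (x, y) := v in
  match val i with
  | 0 => (3 * x, 2 * x + 2 * y)
  | 1 => (3 * x, 2 * y - x)
  | 2 => (3 * y - 3 * x, 2 * y - 4 * x)
  | 3 => (3 * y - 3 * x, - x - y)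
  | 4 => (- 3 * y, 2 * x - 4 * y)
  | _ => (- 3 * y, 2 * x - y)
  end.

Lemma forall_ord6 (P : 'I_6 -> Prop) :
  P (inord 0) -> P (inord 1) -> P (inord 2) -> P (inord 3) -> P (inord 4) ->
  P (inord 5) -> forall i, P i.
Proof.
move=> P0 P1 P2 P3 P4 P5 i; rewrite -[i]inord_val.
by case: i => -[|[|[|[|[|[|m]]]]]] //=.
Qed.

(** Half the sum of the squared edges of the projected triangle, hence invariant under relabelling
    of the vertices. *)
Definition qf v : R := v.1 ^+ 2 - v.1 * v.2 + v.2 ^+ 2.

Lemma qf_ge0 v : 0 <= qf v.
Proof. by rewrite /qf; nra. Qed.

Lemma qf_gt0 v : v <> (0, 0) -> 0 < qf v.
Proof.
case: v => x y v0; rewrite lt_neqAle qf_ge0 andbT eq_sym; apply/eqP => q0.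
apply: v0; rewrite /qf /= in q0.
have x0 : x ^+ 2 = 0 by nra.
have y0 : y ^+ 2 = 0 by nra.
by move/eqP: x0; move/eqP: y0; rewrite !sqrf_eq0 => /eqP -> /eqP ->.
Qed.

Lemma binary_form_ge0 (a b c x y : R) : 0 < c -> b ^+ 2 <= 4 * a * c ->
  0 <= a * x ^+ 2 + b * (x * y) + c * y ^+ 2.
Proof.
move=> c0 d0; rewrite -(pmulr_rge0 _ c0) -(pmulr_rge0 _ (ltr0Sn R 3)).
have -> : 4 * (c * (a * x ^+ 2 + b * (x * y) + c * y ^+ 2)) =
  (2 * c * y + b * x) ^+ 2 + (4 * a * c - b ^+ 2) * x ^+ 2 by ring.
by rewrite addr_ge0 ?sqr_ge0 // mulr_ge0 ?sqr_ge0 // subr_ge0.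
Qed.

(** The differences are positive definite forms. Since [8 / 3 = 6 * (4 / 9)], the ratios
    [qf (child v i) / (6 * qf v)] lie where [parabola] dominates. *)
Lemma qf_child_ge v i : 8 / 3 * qf v <= qf (child v i).
Proof.
case: v => x y; rewrite -subr_ge0; move: i.
apply: forall_ord6; rewrite /qf /child /= inordK //=.
- have := @binary_form_ge0 (13 / 3) (14 / 3) (4 / 3) x y; lra.
- have := @binary_form_ge0 (31 / 3) (- 22 / 3) (4 / 3) x y; lra.
- have := @binary_form_ge0 (31 / 3) (- 40 / 3) (13 / 3) x y; lra.
- have := @binary_form_ge0 (13 / 3) (- 40 / 3) (31 / 3) x y; lra.
- have := @binary_form_ge0 (4 / 3) (- 22 / 3) (31 / 3) x y; lra.
- have := @binary_form_ge0 (4 / 3) (14 / 3) (13 / 3) x y; lra.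
Qed.

(** Relabelling the vertices permutes the six pieces, and the only invariant forms of degrees 2 and
    4 are the multiples of [qf] and of its square. *)
Lemma sum_qf_child v : \sum_(i < 6) qf (child v i) = 48 * qf v.
Proof. case: v => x y; rewrite /qf !big_ord_recl big_ord0 /=; ring. Qed.

Lemma sum_qf_child_sqr v : \sum_(i < 6) qf (child v i) ^+ 2 = 468 * qf v ^+ 2.
Proof. case: v => x y; rewrite /qf !big_ord_recl big_ord0 /=; ring. Qed.

(* Tangent to [x^(-1/2)] at [16/9] and equal to it at [4/9]. *)
Definition parabola (x : R) : R :=
  3 / 4 - 27 / 128 * (x - 16 / 9) + 135 / 512 * (x - 16 / 9) ^+ 2.

Lemma invr_sqrt_le_parabola x : 4 / 9 <= x -> (Num.sqrt x)^-1 <= parabola x.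
Proof.
move=> hx; have x0 : 0 < x by lra.
have := sqr_sqrtr (ltW x0); have : 0 < Num.sqrt x by rewrite sqrtr_gt0.
move: (Num.sqrt x) => t t0 xE.
have ht : 2 / 3 <= t by nra.
rewrite -[leLHS]mul1r ler_pdivrMr // -subr_ge0 -xE.
(* The simple root [2 / 3] and the double root [4 / 3] are the square roots of the crossing point
   [4 / 9] and of the tangency point [16 / 9]. *)
have -> : parabola (t ^+ 2) * t - 1 =
  (t - 2 / 3) * (t - 4 / 3) ^+ 2 * (135 / 512) * (t ^+ 2 + 10 / 3 * t + 16 / 5).
  by rewrite /parabola; field.
apply: mulr_ge0; first apply: mulr_ge0; [apply: mulr_ge0|..]; [lra|exact: sqr_ge0|lra|nra].
Qed.

(* The mean of [parabola] over the six normalised values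
   [qf (child v i) / (6 * qf v)], which does not depend on [v]. *)
Definition decay : R := 3067 / 3072.

Lemma decay_ge0 : 0 <= decay. Proof. by rewrite /decay; lra. Qed.

Lemma decay_lt1 : decay < 1. Proof. by rewrite /decay; lra. Qed.

Lemma sum_invr_sqrt_qf_child v : v <> (0, 0) ->
  \sum_(i < 6) (Num.sqrt (qf (child v i)))^-1
  <= Num.sqrt 6 * decay * (Num.sqrt (qf v))^-1.
Proof.
move=> /qf_gt0 q0; set s := Num.sqrt 6.
have s0 : 0 < s by rewrite sqrtr_gt0.
have s2 : s ^+ 2 = 6 by rewrite sqr_sqrtr.
have t0 : 0 < Num.sqrt (qf v) by rewrite sqrtr_gt0.
have fE i : qf (child v i) = 6 * qf v * (qf (child v i) / (6 * qf v)).
  by rewrite mulrCA divff ?mulr1 // gt_eqF // mulr_gt0.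
apply: (@le_trans _ _ (\sum_(i < 6)
   (s * Num.sqrt (qf v))^-1 * parabola (qf (child v i) / (6 * qf v)))).
  apply: ler_sum => i _; rewrite {1}fE sqrtrM; last by rewrite mulr_ge0 // ltW.
  rewrite sqrtrM // invfM ler_wpM2l ?invr_ge0 ?mulr_ge0 ?(ltW s0) ?(ltW t0) //.
  apply: invr_sqrt_le_parabola; rewrite ler_pdivlMr ?mulr_gt0 //.
  by apply: le_trans (qf_child_ge v i); lra.
rewrite -mulr_sumr.
(* Expanded in powers of its argument, [parabola] only involves the first two moments of the ratios,
   which are known. *)
have -> : \sum_(i < 6) parabola (qf (child v i) / (6 * qf v)) =
  6 * (3 / 4 + 3 / 8 + 5 / 6) - (27 / 128 + 15 / 16) * (48 * qf v / (6 * qf v))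
   + 135 / 512 * (468 * qf v ^+ 2 / (6 * qf v) ^+ 2).
  rewrite -sum_qf_child -sum_qf_child_sqr.
  rewrite !big_ord_recl !big_ord0 /parabola; field; lra.
rewrite invfM mulrAC ler_wpM2r ?invr_ge0 ?(ltW t0) //.
rewrite mulrC ler_pdivrMr //.
have -> : 48 * qf v / (6 * qf v) = 8 by field; lra.
have -> : 468 * qf v ^+ 2 / (6 * qf v) ^+ 2 = 13 by field; lra.
rewrite [leRHS]mulrAC -expr2 s2 /decay; lra.
Qed.

Lemma child_neq0 v i : v <> (0, 0) -> child v i <> (0, 0).
Proof.
move=> /qf_gt0 q0 c0; have := qf_child_ge v i; rewrite c0 /qf /=.
by move: q0; rewrite /qf; lra.
Qed.

Lemma wsum_invr_sqrt_qf n v : v <> (0, 0) ->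
  wsum child n (fun u => (Num.sqrt (qf u))^-1) v
  <= (Num.sqrt 6 * decay) ^+ n * (Num.sqrt (qf v))^-1.
Proof.
elim: n v => [|n IH] v v0 /=; first by rewrite mul1r.
apply: (le_trans (ler_sum _ (fun i _ => IH _ (@child_neq0 v i v0)))).
rewrite -mulr_sumr exprSr -mulrA ler_wpM2l //; last exact: sum_invr_sqrt_qf_child.
by rewrite exprn_ge0 // mulr_ge0 ?sqrtr_ge0 ?decay_ge0.
Qed.

(** Markov's inequality for the power -1/2 of [qf]: the threshold and the mean each contribute a
    factor [Num.sqrt 6 ^+ n]. *)
Lemma wsum_qf_small n v (M : R) : v <> (0, 0) -> 0 <= M ->
  wsum child n (fun u => (qf u <= M * 6 ^+ n)%R%:R) v
  <= 6 ^+ n * decay ^+ n * Num.sqrt (M / qf v).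
Proof.
move=> v0 M0; have q0 := qf_gt0 v v0.
have M60 : 0 <= M * 6 ^+ n by rewrite mulr_ge0 // exprn_ge0.
apply: (@le_trans _ _ (wsum child n
    (fun u => Num.sqrt (M * 6 ^+ n) * (Num.sqrt (qf u))^-1) v)).
  apply: (@le_wsum_rel _ _ _ _ _ (fun _ a b => a = b /\ a <> (0, 0)) _ _ _ 0%N) => //.
    by move=> _ a b i [<- a0]; split=> //; exact: child_neq0.
  move=> a b [<- /qf_gt0 a0]; have s0 : 0 < Num.sqrt (qf a) by rewrite sqrtr_gt0.
  have [aM|_] := leP (qf a); last by rewrite mulr_ge0 ?sqrtr_ge0 ?invr_ge0 ?sqrtr_ge0.
  by rewrite ler_pdivlMr // mul1r ler_wsqrtr.
rewrite wsumZ.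
apply: (le_trans (ler_wpM2l (sqrtr_ge0 _) (wsum_invr_sqrt_qf n v v0))).
rewrite sqrtrM // exprMn sqrtrM // sqrtrV ?(ltW q0) //.
have -> : Num.sqrt (6 ^+ n) = Num.sqrt 6 ^+ n :> R.
  elim: n {M60} => [|n IH]; first by rewrite !expr0 sqrtr1.
  by rewrite !exprS sqrtrM // IH.
have <- : Num.sqrt 6 ^+ n * Num.sqrt 6 ^+ n = 6 ^+ n :> R.
  by rewrite -exprMn -expr2 sqr_sqrtr.
move: (Num.sqrt 6 ^+ n) (decay ^+ n) => a b.
by rewrite le_eqVlt; apply/orP; left; apply/eqP; ring.
Qed.

End Growth.

(** * Integer linear forms along the chain *)

Section Forms.
Context {R : realType}.
Implicit Types (v : R * R) (i : 'I_6) (p : int * int).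

Definition lin_form p v : R := p.1%:~R * v.1 + p.2%:~R * v.2.

Definition pull p i : int * int :=
  let: (b, c) := p in
  match val i with
  | 0 => (3 * b + 2 * c, 2 * c)
  | 1 => (3 * b - c, 2 * c)
  | 2 => (- 3 * b - 4 * c, 3 * b + 2 * c)
  | 3 => (- 3 * b - c, 3 * b - c)
  | 4 => (2 * c, - 3 * b - 4 * c)
  | _ => (2 * c, - 3 * b - c)
  end.

Lemma lin_form_child p v i : lin_form p (child v i) = lin_form (pull p i) v.
Proof.
case: p v => b c [x y]; move: i; apply: forall_ord6;
  rewrite /lin_form /child /pull /= inordK //= ?rmorphD ?rmorphN ?rmorphB ?rmorphM /=; ring.
Qed.

Definition good p : Prop :=
  exists m j e : int, [/\ e = 1 \/ e = - 1, p.1 = 3 * m + e & p.2 = 3 * j + e].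

(** Modulo 3, each of the six pullbacks of [(b, c)] with [b = c] is [(- c, - c)]. *)
Lemma good_pull p i : good p -> good (pull p i).
Proof.
case: p => b c [m [j [e [he /= -> ->]]]]; move: i.
apply: forall_ord6; rewrite /good /pull /= inordK //=.
- exists (3 * m + 2 * j + 2 * e), (2 * j + e), (- e); split; lia.
- exists (3 * m - j + e), (2 * j + e), (- e); split; lia.
- exists (- 3 * m - 4 * j - 2 * e), (3 * m + 2 * j + 2 * e), (- e); split; lia.
- exists (- 3 * m - j - e), (3 * m - j + e), (- e); split; lia.
- exists (2 * j + e), (- 3 * m - 4 * j - 2 * e), (- e); split; lia.
- exists (2 * j + e), (- 3 * m - j - e), (- e); split; lia.
Qed.

Definition size_le (D : int) p := `|p.1| <= D /\ `|p.2| <= D.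

(** [7 = 3 + 4] is the largest absolute row sum of the six matrices. *)
Lemma size_le_pull D p i : size_le D p -> size_le (7 * D) (pull p i).
Proof.
case: p => b c [/= hb hc]; move: i; apply: forall_ord6;
  rewrite /size_le /pull /= inordK //=; lia.
Qed.

Definition cross p q : int := p.1 * q.2 - p.2 * q.1.

(** For a good [(b, c)], [3 * b = 3 * c] modulo 9, so pullback [i] is [c] times [(5, 2)], [(2, 2)]
    or [(2, 5)] as [i %% 3] is 0, 1 or 2. Since [c] is a unit, distinct classes have a nonzero cross
    product modulo 9. *)
Lemma cross_pull_neq0 p q i (j : 'I_6) : good p -> good q -> (i %% 3 != j %% 3)%N ->
  cross (pull p i) (pull q j) != 0.
Proof.
case: p q => [b c] [b' c'].
move=> [m [n [e [he /= -> ->]]]] [m' [n' [e' [he' /= -> ->]]]].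
move: i j; apply: forall_ord6; apply: forall_ord6;
  rewrite /cross /pull /= ?inordK //= => _; case: he => ->; case: he' => ->; lia.
Qed.

Definition small p (K : R) v : R := (lin_form p v ^+ 2 <= K)%R%:R.

Lemma small_child p K v i : small p K (child v i) = small (pull p i) K v.
Proof. by rewrite /small lin_form_child. Qed.

Lemma wsum_small_ge0 k p K v : 0 <= wsum child k (small p K) v.
Proof. by apply: wsum_ge0 => u; rewrite ler0n. Qed.

(** Some word contributes to the sum; [q] is the pullback of [p] along it. *)
Lemma wsum_small_neq0 k D p K v : good p -> size_le D p ->
  wsum child k (small p K) v != 0 ->
  exists q, [/\ good q, size_le (7 ^+ k * D) q & lin_form q v ^+ 2 <= K].
Proof.
elim: k D p v => [|k IH] D p v gp sp.
  rewrite /= /small; case: leP => [h _|_]; last by rewrite eqxx.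
  exists p.
  by split => //; rewrite expr0 mul1r.
rewrite /= psumr_neq0; last by move=> i _; exact: wsum_small_ge0.
move=> /hasP[i _ /andP[_ h]]; have [q [gq sq hq]] := IH _ _ _ gp sp (lt0r_neq0 h).
exists (pull q i); split; [exact: good_pull| |by rewrite -lin_form_child].
by rewrite exprS -mulrA; exact: size_le_pull.
Qed.

(** Cramer's rule: the determinant is a nonzero integer, so the squares of both coordinates of [v]
    are at most [4 * D ^ 2 * K], and [qf] is at most 3/2 of their sum. *)
Lemma qf_le_of_cross (D : int) p q K v :
  size_le D p -> size_le D q -> cross p q != 0 ->
  lin_form p v ^+ 2 <= K -> lin_form q v ^+ 2 <= K -> qf v <= 12 * D%:~R ^+ 2 * K.
Proof.
case: p q v => [p1 p2] [q1 q2] [x y] [/= hp1 hp2] [/= hq1 hq2] d0.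
have sqr_le (z : int) : `|z| <= D -> (z%:~R : R) ^+ 2 <= D%:~R ^+ 2.
  by move=> zD; rewrite -!rmorphXn ler_int; nia.
have d1 : 1 <= ((cross (p1, p2) (q1, q2))%:~R : R) ^+ 2.
  by rewrite -rmorphXn -[leLHS]/(1%:~R) ler_int; nia.
move: (sqr_le _ hp1) (sqr_le _ hp2) (sqr_le _ hq1) (sqr_le _ hq2) d1.
rewrite /cross /lin_form /= rmorphB !rmorphM /= {sqr_le hp1 hp2 hq1 hq2 d0}.
move: (D%:~R ^+ 2) (p1%:~R) (p2%:~R) (q1%:~R) (q2%:~R) => E a b c d.
move=> ha hb hc hd; set s := a * x + b * y; set t := c * x + d * y => d1 hs ht.
have bound (e f : R) : e ^+ 2 <= E -> f ^+ 2 <= E ->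
    (s * e - f * t) ^+ 2 <= 4 * E * K.
  move=> he hf.
  have h1 : s ^+ 2 * e ^+ 2 <= K * E by rewrite ler_pM ?sqr_ge0.
  have h2 : t ^+ 2 * f ^+ 2 <= K * E by rewrite ler_pM ?sqr_ge0.
  have h3 : 0 <= (s * e + f * t) ^+ 2 by exact: sqr_ge0.
  rewrite -subr_ge0; have -> : 4 * E * K - (s * e - f * t) ^+ 2 =
    2 * (K * E - s ^+ 2 * e ^+ 2) + 2 * (K * E - t ^+ 2 * f ^+ 2)
    + (s * e + f * t) ^+ 2 by ring.
  lra.
have hx : x ^+ 2 <= 4 * E * K.
  apply: le_trans (bound d b hd hb).
  have -> : (s * d - b * t) ^+ 2 = (a * d - b * c) ^+ 2 * x ^+ 2.
    by rewrite /s /t; ring.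
  by rewrite ler_peMl ?sqr_ge0.
have hy : y ^+ 2 <= 4 * E * K.
  apply: le_trans (bound c a hc ha).
  have -> : (s * c - a * t) ^+ 2 = (a * d - b * c) ^+ 2 * y ^+ 2.
    by rewrite /s /t; ring.
  by rewrite ler_peMl ?sqr_ge0.
have := sqr_ge0 (x + y); rewrite /qf /=; lra.
Qed.

(** All nonzero terms have their indices in one residue class modulo 3, which has two elements. *)
Lemma sum_same_residue (h : 'I_6 -> R) (M : R) : 0 <= M ->
  (forall i, h i <= M) ->
  (forall i j : 'I_6, (i %% 3 != j %% 3)%N -> h i = 0 \/ h j = 0) ->
  \sum_(i < 6) h i <= 2 * M.
Proof.
move=> M0 hM h0; have [/existsP[i0 hi0]|] := boolP [exists i, h i != 0]; last first.
  rewrite negb_exists => /forallP hz; rewrite big1 ?mulr_ge0 // => i _.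
  by move: (hz i); rewrite negbK => /eqP.
apply: (@le_trans _ _ (\sum_(i < 6) (if (i %% 3 == i0 %% 3)%N then M else 0))).
  apply: ler_sum => i _; case: ifPn => // /h0[-> //|hz].
  by rewrite hz eqxx in hi0.
move: i0 {hi0}; apply: forall_ord6; rewrite !big_ord_recl big_ord0 /= inordK //=; lra.
Qed.

(* Away from a ball of radius of order [sqrt K], at most [B] words of length [k]
   lead to a vector on which the form [p] is smaller than [sqrt K]. *)
Definition rarely_small k p (B : R) : Prop :=
  exists2 C, 0 <= C & forall K v, 0 <= K -> C * K < qf v ->
    wsum child k (small p K) v <= B.

(* For a good form [q], the residue modulo 9 of [pull q i], as a point of the
   projective line, reveals [i %% 3]. So forms obtained through first indices that
   differ modulo 3 are not proportional, and cannot both be small at a large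
   vector: only two first indices out of six contribute. *)
Lemma good_rarely_small k p : good p -> rarely_small k p (2 ^+ k).
Proof.
move=> gp; pose D : int := `|p.1| + `|p.2|.
have sp : size_le D p by rewrite /size_le /D; lia.
elim: k => [|k [C C0 IH]].
  by exists 0 => // K v _ _; rewrite /= /small expr0 lern1; case: leP.
pose E : R := 12 * (7 * (7 ^+ k * D))%:~R ^+ 2.
have E0 : 0 <= E by rewrite mulr_ge0 ?sqr_ge0.
(* [C] makes the induction hypothesis apply at the children, where [qf] is larger; [E] excludes two
   small forms with non-congruent first letters. *)
exists (C + E); first exact: addr_ge0.
move=> K v K0; rewrite mulrDl => hv.
have CK0 : 0 <= C * K by exact: mulr_ge0.
have EK0 : 0 <= E * K by exact: mulr_ge0.
rewrite exprS /=; apply: sum_same_residue; first by rewrite exprn_ge0.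
  by move=> i; apply: IH => //; have := qf_child_ge v i; lra.
move=> i j ij.
have [->|hi] := eqVneq (wsum child k (small p K) (child v i)) 0; first by left.
have [->|hj] := eqVneq (wsum child k (small p K) (child v j)) 0; first by right.
have [q [gq sq hq]] := wsum_small_neq0 k D p K _ gp sp hi.
have [q' [gq' sq' hq']] := wsum_small_neq0 k D p K _ gp sp hj.
rewrite lin_form_child in hq; rewrite lin_form_child in hq'.
have := qf_le_of_cross _ _ _ _ _ (size_le_pull _ _ i sq) (size_le_pull _ _ j sq')
  (cross_pull_neq0 _ _ _ _ gq gq' ij) hq hq'.
by rewrite -/E; lra.
Qed.

Lemma rarely_small_le k p B B' :
  B <= B' -> rarely_small k p B -> rarely_small k p B'.
Proof.
by move=> BB' [C C0 hC]; exists C => // K v K0 hv; apply: le_trans BB'; apply: hC.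
Qed.

Lemma rarely_small0 p : rarely_small 0 p 1.
Proof. by exists 0 => // K v _ _; rewrite /= /small lern1; case: leP. Qed.

(** The last letter is split off here, so the form changes while the starting vector stays. *)
Lemma rarely_small_pull k p (B : 'I_6 -> R) :
  (forall i, rarely_small k (pull p i) (B i)) ->
  rarely_small k.+1 p (\sum_(i < 6) B i).
Proof.
move=> /fin_all_exists2[C C0 hC]; exists (\sum_i C i).
  by apply: sumr_ge0 => i _.
move=> K v K0 hv.
have -> : wsum child k.+1 (small p K) v =
    \sum_(i < 6) wsum child k (small (pull p i) K) v.
  rewrite wsumSr -wsum_sum; congr (wsum child k _ v).
  by apply/funext => u; apply: eq_bigr => i _; rewrite small_child.
apply: ler_sum => i _; apply: hC => //; apply: le_lt_trans hv.
apply: ler_wpM2r => //; rewrite (bigD1 i) //= lerDl.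
by apply: sumr_ge0.
Qed.

Lemma rarely_small_scale k p n B : n != 0 ->
  rarely_small k p B -> rarely_small k (n * p.1, n * p.2) B.
Proof.
move=> n0 [C C0 hC]; exists C => // K v K0 hv; apply: le_trans (hC K v K0 hv).
apply: le_wsum => u; rewrite ler_nat /small.
have np : lin_form p u ^+ 2 <= lin_form (n * p.1, n * p.2) u ^+ 2.
  have -> : lin_form (n * p.1, n * p.2) u = n%:~R * lin_form p u.
    by rewrite /lin_form /= !rmorphM /=; ring.
  rewrite exprMn ler_peMl ?sqr_ge0 //.
  by rewrite -rmorphXn -[leLHS]/(1%:~R) ler_int; nia.
by case: leP => // h; rewrite (le_trans np h).
Qed.

(** The edges [C - A] and [B - C] are not good forms, but all their pullbacks are. *)
Lemma edge_rarely_small k p : p = (0, 1) \/ p = (1, - 1) ->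
  rarely_small k p (6 * 2 ^+ k).
Proof.
move=> hp; case: k => [|k].
  by apply: rarely_small_le (rarely_small0 p); rewrite mulr1 ler1n.
apply: (@rarely_small_le _ _ (\sum_(i < 6) 2 ^+ k)).
  have k0 : 0 <= 2 ^+ k :> R by rewrite exprn_ge0.
  by rewrite !big_ord_recl big_ord0 exprS; lra.
apply: rarely_small_pull => i; apply: good_rarely_small.
case: hp => ->; move: i; apply: forall_ord6; rewrite /good /pull /= inordK //=.
- by exists 1, 1, (- 1); split; lia.
- by exists 0, 1, (- 1); split; lia.
- by exists (- 1), 1, (- 1); split; lia.
- by exists 0, 0, (- 1); split; lia.
- by exists 1, (- 1), (- 1); split; lia.
- by exists 1, 0, (- 1); split; lia.
- by exists 0, (- 1), 1; split; lia.
- by exists 1, (- 1), 1; split; lia.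
- by exists 0, 0, 1; split; lia.
- by exists (- 1), 1, 1; split; lia.
- by exists (- 1), 0, 1; split; lia.
- by exists (- 1), (- 1), 1; split; lia.
Qed.

(** The first edge of a piece is half an edge of its parent, so the form [(1, 0)] never becomes good
    while it reproduces itself: two pullbacks are multiples of it and four of the other edges. The
    recursion [2 * a + 24 * 2 ^+ k] is absorbed by [12 * 4 ^+ k]; any base below 6 would do. *)
Lemma half_edge_rarely_small k : rarely_small k (1, 0) (12 * 4 ^+ k).
Proof.
elim: k => [|k IH].
  by apply: rarely_small_le (rarely_small0 _); rewrite mulr1 ler1n.
have b24 : 2 ^+ k <= 4 ^+ k :> R by rewrite lerXn2r ?nnegrE // ler_nat.
pose B (i : 'I_6) : R := if (i < 2)%N then 12 * 4 ^+ k else 6 * 2 ^+ k.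
apply: (@rarely_small_le _ _ (\sum_i B i)).
  by rewrite !big_ord_recl big_ord0 /B /= exprS; lra.
have e01 := edge_rarely_small k _ (or_introl erefl).
have e11 := edge_rarely_small k _ (or_intror erefl).
apply: rarely_small_pull; apply: forall_ord6; rewrite /B /pull /= inordK //=.
- exact: (rarely_small_scale k (1, 0) 3).
- exact: (rarely_small_scale k (1, 0) 3).
- exact: (rarely_small_scale k (1, - 1) (- 3)).
- exact: (rarely_small_scale k (1, - 1) (- 3)).
- exact: (rarely_small_scale k (0, 1) (- 3)).
- exact: (rarely_small_scale k (0, 1) (- 3)).
Qed.

End Forms.

(** * Angles, areas and edges *)

Section Geometry.
Context {R : realType}.
Implicit Types (t : triangle R) (eps : R).

Definition signed_area2 t : R :=
  ((tB t).1 - (tA t).1) * ((tC t).2 - (tA t).2)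
  - ((tB t).2 - (tA t).2) * ((tC t).1 - (tA t).1).

Lemma sqr_dist (p q : Defs.point R) :
  dist p q ^+ 2 = (p.1 - q.1) ^+ 2 + (p.2 - q.2) ^+ 2.
Proof. by rewrite /dist sqr_sqrtr // addr_ge0 ?sqr_ge0. Qed.

Lemma edges_sorted t :
  [/\ 0 <= shortest t, shortest t <= middle t & middle t <= longest t].
Proof.
rewrite /middle /longest /shortest /edges /=.
have : 0 <= dist (tC t) (tA t) by exact: sqrtr_ge0.
have : 0 <= dist (tB t) (tC t) by exact: sqrtr_ge0.
have : 0 <= dist (tA t) (tB t) by exact: sqrtr_ge0.
move: (dist (tA t) _) (dist (tB t) _) (dist (tC t) _) => e1 e2 e3 h1 h2 h3.
rewrite /Order.max /Order.min.
by case: (ltP e2 e3) => ?; case: (ltP e1 e3) => ?; case: (ltP e1 e2) => ?; split; lra.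
Qed.

(** Heron's formula is symmetric in the three edges, hence holds for them once sorted. *)
Lemma heron t : 4 * signed_area2 t ^+ 2 =
  4 * middle t ^+ 2 * shortest t ^+ 2
  - (middle t ^+ 2 + shortest t ^+ 2 - longest t ^+ 2) ^+ 2.
Proof.
pose S (a b c : R) := 2 * (a * b + b * c + c * a) - a ^+ 2 - b ^+ 2 - c ^+ 2.
transitivity (S (dist (tA t) (tB t) ^+ 2) (dist (tB t) (tC t) ^+ 2)
                (dist (tC t) (tA t) ^+ 2)).
  by rewrite /S !sqr_dist /signed_area2; ring.
rewrite /S /middle /longest /shortest /edges /=.
move: (dist (tA t) _) (dist (tB t) _) (dist (tC t) _) => e1 e2 e3.
rewrite /Order.max /Order.min.
by case: (ltP e2 e3) => ?; case: (ltP e1 e3) => ?; case: (ltP e1 e2) => ?;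
  first [ring | lra].
Qed.

(** Law of cosines in the normalized form, whose sides at the characterizing point have lengths
    [c / a] and [b / a]. *)
Lemma cos_largest_angle_arg t : 0 < shortest t ->
  largest_angle t = acos ((middle t ^+ 2 + shortest t ^+ 2 - longest t ^+ 2)
                          / (2 * middle t * shortest t)).
Proof.
move=> c0; have [_ cb ba] := edges_sorted t; have hr := heron t.
rewrite /largest_angle /angle /char_point /dist /=.
move: (longest t) (middle t) (shortest t) (signed_area2 t) c0 cb ba hr => a b c s.
move=> c0 cb ba hr; have b0 : 0 < b by lra.
have a0 : 0 < a by lra.
set x := (_ / (2 * a ^+ 2)); set w := _ - x ^+ 2.
(* The squared height of the normalized form: on a base of length 1 the height is twice the area. *)
have wE : w = (s / a ^+ 2) ^+ 2.
  have -> : (s / a ^+ 2) ^+ 2 = (4 * s ^+ 2) / (4 * a ^+ 4) by field; lra.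
  by rewrite hr /w /x; field; lra.
have w0 : 0 <= w by rewrite wE sqr_ge0.
have d1 : (x - 0) ^+ 2 + (Num.sqrt w - 0) ^+ 2 = (c / a) ^+ 2.
  by rewrite !subr0 sqr_sqrtr // /w; ring.
have d2 : (x - 1) ^+ 2 + (Num.sqrt w - 0) ^+ 2 = (b / a) ^+ 2.
  by rewrite !subr0 sqr_sqrtr // /w /x; field; lra.
rewrite d1 d2 !sqrtr_sqr !ger0_norm ?divr_ge0 ?ltW //; congr acos.
have -> : (0 - x) * (1 - x) + (0 - Num.sqrt w) * (0 - Num.sqrt w) =
  Num.sqrt w ^+ 2 - x + x ^+ 2 by ring.
by rewrite sqr_sqrtr // /w /x; field; lra.
Qed.

Lemma cos_acos_gt eps (z : R) : 0 < eps -> eps <= 1 -> -1 <= z <= 1 ->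
  acos z < pi - eps -> - cos eps < z.
Proof.
move=> e0 e1 hz hA; have pi2 := @pi_ge2 R.
have hz' : z \in `[(-1), 1] by rewrite in_itv.
have A0 := acos_ge0 hz.
have -> : - cos eps = cos (pi - eps).
  by rewrite -(cosN eps) -cosDpi addrC.
by rewrite -(acosK hz') ltr_cos ?in_itv /= ?A0 ?acos_lepi //; lra.
Qed.

(** Twice the area is [b * c] times the sine of the largest angle, and [c ^+ 2 <= b * c]. That angle
    is at least pi/3 and stays away from pi, so its sine is bounded below. *)
Lemma shortest_sqr_le_area eps : 0 < eps -> exists2 K, 0 <= K &
  forall t, largest_angle t < pi - eps ->
    shortest t ^+ 2 <= K * `|signed_area2 t|.
Proof.
move=> eps0; pose e := Num.min eps 1.
have e0 : 0 < e by rewrite lt_min eps0 ltr01.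
have e1 : e <= 1 by rewrite ge_min lexx orbT.
have ee : e <= eps by rewrite ge_min lexx.
have pi2 := @pi_ge2 R.
(* Bounds the absolute value of the cosine [z]: below by the angle hypothesis, above by 1/2 because
   [a] is the longest edge. *)
pose m : R := Num.max (cos e) (1 / 2).
have cm : cos e <= m by rewrite le_max lexx.
have hm : 1 / 2 <= m by rewrite le_max lexx orbT.
have m1 : m < 1.
  rewrite gt_max; apply/andP; split; last by lra.
  by rewrite -cos0 ltr_cos ?in_itv /=; lra.
have s0 : 0 < Num.sqrt (1 - m ^+ 2) by rewrite sqrtr_gt0; nra.
exists (Num.sqrt (1 - m ^+ 2))^-1; first by rewrite invr_ge0 ltW.
move=> t; have [c0 cb ba] := edges_sorted t; have hr := heron t.
have [cz _|c1] := eqVneq (shortest t) 0.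
  by rewrite cz expr0n /= mulr_ge0 // invr_ge0 ltW.
have {c1}c0 : 0 < shortest t by rewrite lt_neqAle eq_sym c1.
rewrite (cos_largest_angle_arg t c0).
move: (longest t) (middle t) (shortest t) (signed_area2 t) c0 cb ba hr => a b c s.
move=> c0 cb ba hr; have b0 : 0 < b by lra.
set z := _ / _.
have zE : b ^+ 2 + c ^+ 2 - a ^+ 2 = z * (2 * b * c) by rewrite /z; field; lra.
have bc0 : 0 < b * c by rewrite mulr_gt0.
have hs : s ^+ 2 = (b * c) ^+ 2 * (1 - z ^+ 2) by move: hr; rewrite zE; lra.
have z1 : z ^+ 2 <= 1.
  by rewrite -subr_ge0 -(pmulr_rge0 _ (exprn_gt0 2 bc0)) -hs sqr_ge0.
have zh : z <= 1 / 2.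
  rewrite ler_pdivrMr; last by rewrite !mulr_gt0.
  have : a ^+ 2 >= b ^+ 2 by rewrite ler_pXn2r ?nnegrE //; lra.
  by nra.
have zb : -1 <= z <= 1 by apply/andP; split; nra.
move=> hA; have zm : - cos e < z by apply: cos_acos_gt => //; lra.
have z2 : z ^+ 2 <= m ^+ 2 by nra.
rewrite mulrC ler_pdivlMr // -ler_sqr ?nnegrE ?mulr_ge0 ?(ltW c0) ?(ltW s0) //.
rewrite real_normK ?num_real // hs exprMn sqr_sqrtr; last by nra.
apply: ler_pM; rewrite ?sqr_ge0 //; first by nra.
- by rewrite ler_pXn2r ?nnegrE ?sqr_ge0 ?(ltW bc0) // expr2 ler_wpM2r // ltW.
- lra.
Qed.

Lemma signed_area2_subdiv t i : signed_area2 (subdiv t i) = signed_area2 t / 6.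
Proof.
case: t => [[[a1 a2] [b1 b2]] [c1 c2]]; move: i; apply: forall_ord6;
  rewrite /signed_area2 /subdiv /barycenter /midpoint /tA /tB /tC /= inordK //=; by field.
Qed.

Definition scaled_vec (l : Defs.point R -> R) n t : R * R :=
  (6 ^+ n * (l (tB t) - l (tA t)), 6 ^+ n * (l (tC t) - l (tA t))).

Lemma scaled_vec_subdiv (l : Defs.point R -> R) n t i : l = fst \/ l = snd ->
  scaled_vec l n.+1 (subdiv t i) = child (scaled_vec l n t) i.
Proof.
move=> hl; rewrite /scaled_vec exprS; move: (6 ^+ n) => q.
case: t => [[[a1 a2] [b1 b2]] [c1 c2]]; case: hl => ->; move: i;
apply: forall_ord6; rewrite /subdiv /barycenter /midpoint /tA /tB /tC /= inordK //=;
  congr (_, _); by field.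
Qed.

End Geometry.

(** * Passage to the limit *)

Section Limit.
Context {R : realType}.

Lemma exprn_small (z a e : R) : 0 <= z -> z < 1 -> 0 < e ->
  exists N, forall n, (N <= n)%N -> a * z ^+ n < e.
Proof.
move=> z0 z1 e0.
have z1' : `|z| < 1 by rewrite ger0_norm.
have /cvgr0Pnorm_lt /(_ _ e0)[N _ HN] := @cvg_geometric R a z z1'.
by exists N => n Nn; apply: le_lt_trans (HN n Nn); exact: ler_norm.
Qed.

(** First [k] is fixed so that [12 * (2 / 3) ^+ k] is small. The first [m] letters make [qf] large
    outside an event of vanishing probability; from such a vector, few of the last [k] letters make
    the form small. *)
Lemma rarely_small_vanish (p : int * int) (M e : R) v :
  (forall k, @rarely_small R k p (12 * 4 ^+ k)) -> v <> (0, 0) -> 0 <= M -> 0 < e ->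
  exists N, forall n, (N <= n)%N ->
    wsum child n (small p (M * 6 ^+ n)) v / 6 ^+ n < e.
Proof.
move=> hp v0 M0 e0; have e2 : 0 < e / 2 by rewrite divr_gt0.
have [k /(_ k (leqnn k)) hk] := @exprn_small (2 / 3) 12 (e / 2)
  ltac:(lra) ltac:(lra) e2.
have [C C0 hC] := hp k.
(* Chosen so that [L * 6 ^+ m] equals [C * K] for the threshold [K] at time [m + k]. *)
pose L := C * M * 6 ^+ k.
have L0 : 0 <= L by rewrite !mulr_ge0 ?exprn_ge0.
have [N hN] := @exprn_small decay (Num.sqrt (L / qf v)) (e / 2)
  decay_ge0 decay_lt1 e2.
exists (N + k)%N => n Nn; pose m := (n - k)%N.
have nE : n = (m + k)%N by lia.
have {Nn}/hN hm : (N <= m)%N by lia.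
rewrite nE; set K := M * _.
have K0 : 0 <= K by rewrite mulr_ge0 ?exprn_ge0.
have q0 j : 0 < 6 ^+ j :> R by rewrite exprn_gt0.
rewrite ltr_pdivrMr // wsumD.
apply: (@le_lt_trans _ _ (wsum child m (fun u =>
  12 * 4 ^+ k + 6 ^+ k * (qf u <= L * 6 ^+ m)%R%:R) v)).
  apply: le_wsum => u; case: (leP (qf u) (L * 6 ^+ m)) => hu /=.
    rewrite mulr1; apply: (@le_trans _ _ (6 ^+ k)); last first.
      by rewrite lerDr mulr_ge0 ?exprn_ge0.
    rewrite -[leRHS]mulr1 -(wsum_cst child k 1 u); apply: le_wsum => x.
    by rewrite /small lern1; case: leP.
  rewrite mulr0 addr0; apply: hC => //; apply: le_lt_trans hu.
  by rewrite /K /L exprD le_eqVlt; apply/orP; left; apply/eqP; ring.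
rewrite wsum_add wsum_cst wsumZ.
have := @wsum_qf_small R m v L v0 L0.
rewrite -(ler_pM2l (q0 k)) => hq.
apply: (le_lt_trans (lerD (lexx _) hq)).
have h4 : 12 * 4 ^+ k = 6 ^+ k * (12 * (2 / 3) ^+ k) :> R.
  rewrite mulrCA -exprMn; congr (12 * _ ^+ k); lra.
rewrite h4 exprD.
move: (q0 k) (q0 m) hk hm; rewrite {hq h4}.
move: (6 ^+ k) (6 ^+ m) (12 * _) (Num.sqrt _) (decay ^+ m) => a b c s d.
move=> a0 b0 hk hm.
have -> : b * (a * c) + a * (b * d * s) = b * a * (c + s * d) by ring.
by rewrite [ltRHS]mulrC ltr_pM2l ?mulr_gt0 //; lra.
Qed.

Lemma dist_sym (p q : Defs.point R) : dist p q = dist q p.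
Proof. by rewrite /dist; congr Num.sqrt; ring. Qed.

(** A projection shortens the shortest edge, which is one of the three; rescaling multiplies its
    square by [6 ^+ n] twice, and [M] absorbs one factor. *)
Lemma scaled_vec_edge_small (l : Defs.point R -> R) (M : R) n t :
  l = fst \/ l = snd -> shortest t ^+ 2 * 6 ^+ n <= M ->
  let v := scaled_vec l n t in
  1 <= small (1, 0) (M * 6 ^+ n) v + small (0, 1) (M * 6 ^+ n) v
       + small (1, - 1) (M * 6 ^+ n) v.
Proof.
move=> hl hM /=.
have q0 : 0 < 6 ^+ n :> R by rewrite exprn_gt0.
have ld p q : (l p - l q) ^+ 2 <= dist p q ^+ 2.
  by rewrite sqr_dist; case: hl => ->; rewrite ?lerDl ?lerDr sqr_ge0.
have small1 (r : int * int) v p q : lin_form r v = 6 ^+ n * (l p - l q) ->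
    dist p q ^+ 2 * 6 ^+ n <= M -> small r (M * 6 ^+ n) v = 1.
  move=> rE h; rewrite /small rE.
  suff -> : (6 ^+ n * (l p - l q)) ^+ 2 <= M * 6 ^+ n by [].
  rewrite exprMn expr2 mulrAC ler_pM2r // mulrC; apply: le_trans h.
  by rewrite ler_pM2r.
have s0 (r : int * int) v : 0 <= small r (M * 6 ^+ n) v by rewrite ler0n.
have [h|[h|h]] : shortest t = dist (tA t) (tB t) \/
    shortest t = dist (tB t) (tC t) \/ shortest t = dist (tC t) (tA t).
- rewrite /shortest /edges /= /Order.min.
  by case: (ltP (dist (tB t) (tC t))) => _; case: ltP => _; auto.
- have := small1 (1, 0) (scaled_vec l n t) (tB t) (tA t); rewrite dist_sym -h.
  move=> -> //; last by rewrite /lin_form /scaled_vec /=; ring.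
  by have := s0 (0, 1) (scaled_vec l n t); have := s0 (1, - 1) (scaled_vec l n t); lra.
- have := small1 (1, - 1) (scaled_vec l n t) (tB t) (tC t); rewrite -h.
  move=> -> //; last by rewrite /lin_form /scaled_vec /=; ring.
  by have := s0 (0, 1) (scaled_vec l n t); have := s0 (1, 0) (scaled_vec l n t); lra.
- have := small1 (0, 1) (scaled_vec l n t) (tC t) (tA t); rewrite -h.
  move=> -> //; last by rewrite /lin_form /scaled_vec /=; ring.
  by have := s0 (1, 0) (scaled_vec l n t); have := s0 (1, - 1) (scaled_vec l n t); lra.
Qed.

Lemma scaled_vec0_neq0 (t : triangle R) : not_all_equal t ->
  exists2 l, l = fst \/ l = snd & scaled_vec l 0 t <> (0, 0).
Proof.
move=> ht; apply: contrapT => hl; apply: ht.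
have h (l : Defs.point R -> R) : l = fst \/ l = snd ->
    l (tB t) = l (tA t) /\ l (tC t) = l (tA t).
  move=> ll; have : scaled_vec l 0 t = (0, 0).
    by apply: contrapT => hv; apply: hl; exists l.
  by rewrite /scaled_vec !mul1r => -[/eqP + /eqP]; rewrite !subr_eq0 => /eqP -> /eqP.
have [b1 c1] := h fst (or_introl erefl); have [b2 c2] := h snd (or_intror erefl).
move: b1 c1 b2 c2; case: (tA t) (tB t) (tC t) => [a1 a2] [b1 b2] [c1 c2] /=.
by move=> -> -> -> ->.
Qed.

End Limit.

Theorem theorem2 (R : realType) (t0 : triangle R) (eps : R) :
  not_all_equal t0 -> 0 < eps ->
  (prob_angle_lt t0 eps : R^o^nat) @ \oo --> (0 : R^o).
Proof.
move=> ht eps0; have [K K0 hK] := shortest_sqr_le_area eps eps0.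
have [l hl v0] := scaled_vec0_neq0 t0 ht.
pose M := K * `|signed_area2 t0|; pose v := scaled_vec l 0 t0.
have M0 : 0 <= M by rewrite mulr_ge0.
have ub n : prob_angle_lt t0 eps n <=
    wsum child n (small (1, 0) (M * 6 ^+ n)) v / 6 ^+ n
    + wsum child n (small (0, 1) (M * 6 ^+ n)) v / 6 ^+ n
    + wsum child n (small (1, - 1) (M * 6 ^+ n)) v / 6 ^+ n.
  rewrite prob_angle_ltE -!mulrDl -!wsum_add ler_pM2r ?invr_gt0 ?exprn_gt0 //.
  (* The coupling also records the exact area, which turns the bound of the squared shortest edge by
     the area into [M / 6 ^+ n]. *)
  pose rel k t u :=
    u = scaled_vec l k t /\ signed_area2 t * 6 ^+ k = signed_area2 t0.
  apply: (@le_wsum_rel _ _ _ _ _ rel _ _ _ 0%N).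
  - move=> k t u i [-> hk]; split; first by rewrite scaled_vec_subdiv.
    by rewrite signed_area2_subdiv exprS -hk; field.
  - move=> t u [-> hk]; case: ltP => [hA|_]; last by rewrite !addr_ge0 ?ler0n.
    apply: scaled_vec_edge_small => //; rewrite add0n in hk.
    have q0 : 0 <= 6 ^+ n :> R by rewrite exprn_ge0.
    rewrite /M -hk normrM (ger0_norm q0) mulrA.
    by rewrite ler_pM2r ?exprn_gt0 //; exact: hK.
  - by split; rewrite ?mulr1.
apply/cvgr0Pnorm_lt => e e0.
have e3 : 0 < e / 3 by rewrite divr_gt0.
have r01 k p : p = (0, 1) \/ p = (1, - 1) -> @rarely_small R k p (12 * 4 ^+ k).
  move=> /(@edge_rarely_small R k) hp; apply: rarely_small_le hp.
  have : 2 ^+ k <= 4 ^+ k :> R by rewrite lerXn2r ?nnegrE // ler_nat.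
  have : 0 <= 4 ^+ k :> R by rewrite exprn_ge0.
  lra.
have [N1 h1] := rarely_small_vanish _ _ _ v half_edge_rarely_small v0 M0 e3.
have [N2 h2] := rarely_small_vanish _ _ _ v
  (fun k => r01 k _ (or_introl erefl)) v0 M0 e3.
have [N3 h3] := rarely_small_vanish _ _ _ v
  (fun k => r01 k _ (or_intror erefl)) v0 M0 e3.
exists (N1 + N2 + N3)%N => // n /= hn.
rewrite ger0_norm; last by rewrite divr_ge0.
apply: (le_lt_trans (ub n)).
have := h1 n ltac:(lia); have := h2 n ltac:(lia); have := h3 n ltac:(lia).
lra.
Qed.
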